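(* (Analog model.) Let $M\le N$ and $K_f<N$ be positive integers, let $\mathbf{A}\in\mathbb{C}^{M\times N}$ be the sampling matrix of the analog model, and let $\mathbf{\Phi}=\bar{\mathbf{A}}\odot\mathbf{A}\in\mathbb{C}^{M^2\times N}$. For each $f\in\mathcal{F}_s$ let $S=S(f)\subset\{1,\dots,N\}$ be the known set of $K_f$ indices of the potentially nonzero entries of $\mathbf{r_x}(f)$. If $\mathbf{A}$ is full spark, $M^2\ge K_f$ and $2M>K_f$, then for every $f\in\mathcal{F}_s$ the reduced linear system $\mathbf{r_z}(f)=\mathbf{\Phi}_S\,\mathbf{r}_{\mathbf{x}}^S(f)$ in the unknown $\mathbf{r}_{\mathbf{x}}^S(f)\in\mathbb{C}^{K_f}$ has a unique solution. (Digital model.) Let $M< N$ and $K_f<N$ be positive integers, let $\mathbf{A}\in\mathbb{C}^{M\times N}$ be the sampling matrix of the digital model, let $\mathbf{F}$ be the $N\times N$ DFT matrix, $\mathbf{G}=\frac1N\mathbf{A}\mathbf{F}^H$ and $\mathbf{\Phi}=\bar{\mathbf{G}}\odot\mathbf{G}\in\mathbb{C}^{M^2\times N}$. Let $S\subset\{1,\dots,N\}$ be the known set of $K_f$ indices of the potentially nonzero entries of $\mathbf{r_c}$. If $\mathbf{A}\mathbf{F}^H$ is full spark, $M^2\ge K_f$ and $2M>K_f$, then the reduced linear system $\mathbf{r_z}=\mathbf{\Phi}_S\,\mathbf{r}_{\mathbf{c}}^S$ in the unknown $\mathbf{r}_{\mathbf{c}}^S\in\mathbb{C}^{K_f}$ has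 a unique solution.
   Context: An $M\times N$ matrix with $M\le N$ is full spark if every $M$ of its columns are linearly independent. $\bar{\mathbf{T}}$ is the entrywise complex conjugate of $\mathbf{T}$, $(\cdot)^H$ the conjugate transpose, $\otimes$ the Kronecker product. The Khatri–Rao product $\bar{\mathbf{T}}\odot\mathbf{T}$ is the $M^2\times N$ matrix whose $j$th column is $\bar{\mathbf{t}}_j\otimes\mathbf{t}_j$, where $\mathbf{t}_j$ is the $j$th column of $\mathbf{T}$. $\text{vec}$ stacks the columns of a matrix. For an index set $S$, $\mathbf{\Phi}_S$ is the submatrix of $\mathbf{\Phi}$ consisting of the columns indexed by $S$, and $\mathbf{r}^S$ is the subvector of $\mathbf{r}$ of entries indexed by $S$. Analog model. $\mathcal{F}_s=[-f_s/2,f_s/2]$ is a frequency interval. For each $f\in\mathcal{F}_s$ the vector of sample spectra is $\mathbf{z}(f)=\mathbf{A}\mathbf{x}(f)$, where $\mathbf{x}(f)\in\mathbb{C}^N$ contains the $N$ spectral bins (frequency slices of length $f_s$) of a wide-sense stationary signal. By stationarity, $\mathbf{R_x}(f)=\mathbb{E}[\mathbf{x}(f)\mathbf{x}^H(f)]$ is diagonal; its diagonal, written as a vector, is $\mathbf{r_x}(f)\in\mathbb{C}^N$ and vanishes outside $S(f)$. The measured data are $\mathbf{R_z}(f)=\mathbb{E}[\mathbf{z}(f)\mathbf{z}^H(f)]=\mathbf{A}\mathbf{R_x}(f)\mathbf{A}^H$ and $\mathbf{r_z}(f)=\text{vec}(\mathbf{R_z}(f))=\mathbf{\Phi}\,\mathbf{r_x}(f)=\mathbf{\Phi}_S\,\mathbf{r}_{\mathbf{x}}^S(f)$.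 Digital model. $\mathbf{z}=\mathbf{A}\mathbf{x}$, where $\mathbf{x}$ is the vector of $N$ Nyquist samples of the signal, $\mathbf{x}=\frac1N\mathbf{F}^H\mathbf{c}$ with $\mathbf{c}$ the vector of Fourier coefficients, so $\mathbf{z}=\mathbf{G}\mathbf{c}$. By stationarity, $\mathbf{R_c}=\mathbb{E}[\mathbf{c}\mathbf{c}^H]$ is diagonal, with diagonal vector $\mathbf{r_c}\in\mathbb{C}^N$ vanishing outside $S$. The measured data are $\mathbf{R_z}=\mathbb{E}[\mathbf{z}\mathbf{z}^H]=\mathbf{G}\mathbf{R_c}\mathbf{G}^H$ and $\mathbf{r_z}=\text{vec}(\mathbf{R_z})=\mathbf{\Phi}\,\mathbf{r_c}=\mathbf{\Phi}_S\,\mathbf{r}_{\mathbf{c}}^S$. In both models the data vector on the left-hand side arises from an actual signal with the given support, so it lies in the range of $\mathbf{\Phi}_S$. *)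

(* Defs.v *)
From HB Require Import structures.
From mathcomp Require Export all_boot all_order all_algebra.
From mathcomp Require Export all_classical all_reals all_analysis.
From mathcomp Require Export spectral complex mxtens.

Set Implicit Arguments.
Unset Strict Implicit.
Unset Printing Implicit Defensive.

Import Order.TTheory GRing.Theory Num.Theory.
Import numFieldNormedType.Exports.

Local Open Scope ring_scope.
Local Open Scope sesquilinear_scope.
Local Open Scope complex_scope.

(* The columns of A indexed by S, in increasing order. *)
Definition colset (F : Type) (m n : nat) (S : {set 'I_n}) (A : 'M[F]_(m, n)) :
    'M[F]_(m, #|S|) :=
  colsub (fun k : 'I_#|S| => enum_val k) A.

(* [row_free] of the transpose is linear independence of the columns. The
   notion is only meant for m <= n: it is vacuous otherwise. *)
Definition full_spark (F : fieldType) (m n : nat) (A : 'M[F]_(m, n)) : Prop :=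
  forall S : {set 'I_n}, #|S| = m -> row_free (colset S A)^T.

(* [*t] is the Kronecker product; a product of two columns has 1 * 1 columns. *)
Definition khatri_rao (F : pzRingType) (m p n : nat)
    (A : 'M[F]_(m, n)) (B : 'M[F]_(p, n)) : 'M[F]_(m * p, n) :=
  \matrix_(i, j) (col j A *t col j B) i (ord0 : 'I_(1 * 1)).

(* [mxvec] stacks rows, hence the inner transpose. *)
Definition vec (F : Type) (m n : nat) (A : 'M[F]_(m, n)) : 'cV[F]_(n * m) :=
  (mxvec A^T)^T.

Lemma index_allpairs (T1 T2 : eqType) (s : seq T1) (t : seq T2) x y :
  x \in s -> y \in t ->
  index (x, y) [seq (a, b) | a <- s, b <- t] = (index x s * size t + index y t)%N.
Proof.
move=> + yt; elim: s => //= a s IHs; rewrite inE index_cat => xs.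
have [->|ax] := eqVneq a x.
  rewrite map_f // mul0n add0n index_map //.
  by move=> b c [].
rewrite ifN; last by apply/mapP => -[b _ [/eqP]]; rewrite eq_sym (negPf ax).
rewrite size_map IHs ?mulSn ?addnA //.
by case/orP: xs => // /eqP xa; rewrite xa eqxx in ax.
Qed.

Lemma mxvec_index_val (m n : nat) (i : 'I_m) (j : 'I_n) :
  mxvec_index i j = mxtens_index (i, j).
Proof.
apply: val_inj => /=.
rewrite /enum_rank [enum_rank_in]unlock insubdK /=; last first.
  by rewrite -topredE /= cardE index_mem mem_enum.
by rewrite enumT unlock index_allpairs ?mem_enum // !index_enum_ord size_enum_ord.
Qed.

(* Entry (i, j) of A sits at position j * m + i of [vec A], as in the indexing
   of Kronecker products. *)
Lemma vecE (F : Type) (m n : nat) (A : 'M[F]_(m, n)) (i : 'I_m) (j : 'I_n) k :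
  vec A (mxtens_index (j, i)) k = A i j.
Proof. by rewrite mxE -mxvec_index_val ord1 mxvecE mxE. Qed.

(* The N x N DFT matrix, with entries exp(- 2 pi i j k / N). *)
Definition dftmx (R : realType) (N : nat) : 'M[R[i]]_N :=
  \matrix_(j, k) let t := 2 * pi * (j * k)%N%:R / N%:R in cos t -i* sin t.

Section RandomVectors.
Context (d : measure_display) (T : measurableType d) (R : realType).
Variable P : probability T R.

Definition square_integrable (n : nat) (X : T -> 'cV[R[i]]_n) : Prop :=
  forall k : 'I_n,
    (fun w => complex.Re (X w k 0)) \in Lfun P 2%:E /\
    (fun w => complex.Im (X w k 0)) \in Lfun P 2%:E.

(* Meaningful when the real and imaginary parts of Z are integrable, [fine]
   then being harmless. *)
Definition cexpectation (Z : T -> R[i]) : R[i] :=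
  fine 'E_P[fun w => complex.Re (Z w)] +i* fine 'E_P[fun w => complex.Im (Z w)].

(* E[X X^H] *)
Definition correlation_mx (n : nat) (X : T -> 'cV[R[i]]_n) : 'M[R[i]]_n :=
  \matrix_(i, j) cexpectation (fun w => (X w *m (X w)^t*) i j).

End RandomVectors.

(* Main.v *)
(* Bilinearity of the expectation gives R_z = A R_x A^H with R_x diagonal, so
   r_x solves the system. For uniqueness, suppose A_S diag(r) A_S^H = 0 and let
   j be in S. As #|S \ {j}| <= 2M - 2, split S \ {j} into two sets of fewer than
   M elements; full spark provides row vectors u and v such that u A and v A are
   1 at j and u A (resp. v A) vanishes on the first (resp. second) set. Then
   0 = u A_S diag(r) A_S^H v^H = r_j. *)

Require Import Defs.
From mathcomp Require Import zify ring.

Set Implicit Arguments.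
Unset Strict Implicit.
Unset Printing Implicit Defensive.

Import Order.TTheory GRing.Theory Num.Theory.
Import numFieldNormedType.Exports.

Local Open Scope ring_scope.
Local Open Scope sesquilinear_scope.
Local Open Scope complex_scope.

(** * Column selection, vectorization and the Khatri-Rao product *)

Lemma subset_of_card (T : finType) (A : {set T}) (k : nat) :
  (k <= #|A|)%N -> exists2 B : {set T}, B \subset A & #|B| = k.
Proof.
move=> lekA; exists [set x in take k (enum A)].
  by apply/fintype.subsetP => x; rewrite inE => /mem_take; rewrite mem_enum.
rewrite cardsE (card_uniqP (take_uniq _ (enum_uniq _))) size_take -cardE.
by case: ltngtP lekA.
Qed.

Lemma colset_mulmx (F : pzRingType) (m n : nat) (S : {set 'I_n})
    (A : 'M[F]_(m, n)) (r : 'cV[F]_n) :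
  (forall j, j \notin S -> r j 0 = 0) ->
  A *m r = colset S A *m rowsub (fun k : 'I_#|S| => enum_val k) r.
Proof.
move=> r0; apply/colP => i; rewrite !mxE.
rewrite (bigID (mem S)) /= [X in _ + X]big1 => [|j /r0 ->]; last by rewrite mulr0.
rewrite addr0 big_enum_val.
by apply: eq_bigr => k _; rewrite !mxE.
Qed.

Lemma colset_khatri_rao (F : pzRingType) (m p n : nat) (S : {set 'I_n})
    (A : 'M[F]_(m, n)) (B : 'M[F]_(p, n)) :
  colset S (khatri_rao A B) = khatri_rao (colset S A) (colset S B).
Proof. by apply/matrixP => i j; rewrite !mxE. Qed.

Lemma vec_inj (F : Type) (m n : nat) : injective (@vec F m n).
Proof.
move=> A B AB; apply/matrixP => i j.
by rewrite -(vecE A i j 0) AB vecE.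
Qed.

(** The matrix is the sum over [l] of [r l] times the rank-one product of column [l] of [B] with the
    transposed column [l] of [A], and [vec] sends b a^T to the Kronecker product of a and b. This
    turns the linear system into a matrix equation. *)
Lemma vec_mul_diag (F : comPzRingType) (m p n : nat)
    (A : 'M[F]_(m, n)) (B : 'M[F]_(p, n)) (r : 'cV[F]_n) :
  vec (B *m diag_mx r^T *m A^T) = khatri_rao A B *m r.
Proof.
apply/colP => l; case: (mxtens_indexP l) => j i.
rewrite vecE mul_mx_diag !mxE; apply: eq_bigr => k _; rewrite !mxE.
by rewrite !mxtens_indexK /= mulrAC [_ * A j k]mulrC.
Qed.

(** * Full spark matrices *)

Lemma full_sparkZ (F : fieldType) (m n : nat) (a : F) (A : 'M[F]_(m, n)) :
  a != 0 -> full_spark A -> full_spark (a *: A).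
Proof.
move=> a0 sA S cS.
have -> : colset S (a *: A) = a *: colset S A by apply/matrixP => i j; rewrite !mxE.
by rewrite linearZ /= /row_free mxrank_scale_nz //; apply: sA.
Qed.

(** Complete [j |: S] to a set of m column indices. The square submatrix on these columns is
    invertible by full spark, and [u] is the row of its inverse that belongs to [j]. *)
Lemma full_spark_separate (F : fieldType) (m n : nat) (A : 'M[F]_(m, n))
    (j : 'I_n) (S : {set 'I_n}) :
  (m <= n)%N -> full_spark A -> j \notin S -> (#|S| < m)%N ->
  exists u : 'rV[F]_m,
    (u *m A) 0 j = 1 /\ {in S, forall k, (u *m A) 0 k = 0}.
Proof.
move=> lemn sA jS ltSm.
(* The padding [V] exists because m <= n leaves enough indices outside [j |: S]. *)
have [|V sV cV] := @subset_of_card _ (~: (j |: S)) (m - #|j |: S|).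
  by rewrite [leqRHS]cardsCs finset.setCK card_ord leq_sub2r.
pose U := (j |: S) :|: V.
have cU : #|U| = m.
  rewrite cardsU finset.disjoint_setI0; last by rewrite disjoint_sym finset.disjoints_subset.
  by rewrite cards0 subn0 cV subnKC // cardsU1 jS.
have /row_freeP[B /(congr1 trmx)] := sA U cU.
rewrite trmx_mul trmxK trmx1 => BU1.
have jU : j \in U by rewrite !inE eqxx.
have uE k : k \in U -> (row (enum_rank_in jU j) B^T *m A) 0 k = (j == k)%:R.
  move=> kU; have /matrixP/(_ (enum_rank_in jU j) (enum_rank_in jU k)) := BU1.
  rewrite !mxE (can_in_eq (enum_rankK_in jU)) // => <-.
  by apply: eq_bigr => i _; rewrite !mxE enum_rankK_in.
exists (row (enum_rank_in jU j) B^T); split; first by rewrite uE ?eqxx.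
move=> k kS; rewrite uE ?inE ?kS ?orbT //.
by case: eqP jS kS => // -> /negPf ->.
Qed.

(** In the application [f] is complex conjugation; it enters only through its compatibility with
    products, sums, 0 and 1. *)
Lemma full_spark_khatri_rao_inj (F : fieldType) (f : {rmorphism F -> F})
    (m n : nat) (A : 'M[F]_(m, n)) (S : {set 'I_n}) (r : 'cV[F]_#|S|) :
  (m <= n)%N -> full_spark A -> (#|S| < 2 * m)%N ->
  colset S (khatri_rao (map_mx f A) A) *m r = 0 -> r = 0.
Proof.
move=> lemn sA ltS.
rewrite colset_khatri_rao -vec_mul_diag.
have <- : vec 0 = 0 :> 'cV[F]_(m * m) by rewrite /vec !linear0.
move=> /vec_inj A0; apply/colP => k; rewrite [RHS]mxE.
set j := enum_val k; have jS : j \in S := enum_valP k.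
have cSj : (#|S :\ j| = #|S|.-1)%N by rewrite (cardsD1 j S) jS.
(* The minimum covers a small [S], where [S1] is all of [S :\ j]. Otherwise [S1] has m - 1 elements,
   and at most (2m - 2) - (m - 1) = m - 1 remain for [v]. *)
have [S1 S1S cS1] := subset_of_card (geq_minr m.-1 #|S :\ j|).
have m_gt0 : (0 < m)%N by case: (m) ltS.
have [||u [uj u0]] := full_spark_separate (j := j) (S := S1) lemn sA.
- by apply/negP => /(fintype.subsetP S1S); rewrite !inE eqxx.
- by rewrite cS1 gtn_min; lia.
have [||v [vj v0]] := full_spark_separate (j := j) (S := S :\ j :\: S1) lemn sA.
- by rewrite !inE eqxx andbF.
- by rewrite cardsDS // cS1 cSj; lia.
(* The sum is the expansion of u A_S diag(r) f(A_S)^T f(v)^T, whose three middle factors multiply to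
   0 by [A0]. *)
have : \sum_l (u *m A) 0 (enum_val l) * r l 0 * f ((v *m A) 0 (enum_val l)) = 0.
  transitivity ((u *m (colset S A *m diag_mx r^T *m (colset S (map_mx f A))^T)
    *m (map_mx f v)^T) 0 0); last by rewrite A0 mulmx0 mul0mx mxE.
  have -> : colset S (map_mx f A) = map_mx f (colset S A).
    by apply/matrixP => i l; rewrite !mxE.
  rewrite !mulmxA -mulmxA -trmx_mul -map_mxM mul_mx_diag !mulmx_colsub mxE.
  by apply: eq_bigr => l _; rewrite !mxE.
(* The term at [k] is [r k 0]; any other index is in [S1], where [u] kills the term, or in the rest,
   where [v] does. *)
rewrite (bigD1 k) //= uj vj rmorph1 mul1r mulr1 big1 ?addr0 // => l lk.
have lj : enum_val l != j by rewrite (inj_eq enum_val_inj).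
have [lS1|lS1] := boolP (enum_val l \in S1); first by rewrite u0 // !mul0r.
by rewrite v0 ?rmorph0 ?mulr0 // !inE lS1 lj enum_valP.
Qed.

(** * Linearity of the complex expectation and correlation matrices *)

Lemma fine_expectation_lin (d : measure_display) (T : measurableType d)
    (R : realType) (P : probability T R) (a b : R) (X Y : T -> R) :
  X \in Lfun P 1 -> Y \in Lfun P 1 ->
  (fun w => a * X w + b * Y w) \in Lfun P 1 /\
  fine 'E_P[fun w => a * X w + b * Y w] = a * fine 'E_P[X] + b * fine 'E_P[Y].
Proof.
move=> X1 Y1; have aX1 := Lfun_scale a (lexx 1) X1.
have bY1 := Lfun_scale b (lexx 1) Y1.
have -> : (fun w => a * X w + b * Y w) = (a \o* X) \+ (b \o* Y).
  by apply/funext => w /=; rewrite ![_ * a]mulrC ![_ * b]mulrC.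
split; first exact: rpredD.
rewrite expectationD // !expectationZl // fineD ?fin_numM ?expectation_fin_num //.
by rewrite !fineM ?expectation_fin_num.
Qed.

Section ComplexExpectation.
Context (d : measure_display) (T : measurableType d) (R : realType).
Variable P : probability T R.

Definition cintegrable (Z : T -> R[i]) : Prop :=
  (fun w => complex.Re (Z w)) \in Lfun P 1 /\
  (fun w => complex.Im (Z w)) \in Lfun P 1.

(** Integrability is carried along with the value: [fine] sends an infinite expectation to 0, so the
    value alone would not obey linearity. *)
Definition is_cexpectation (Z : T -> R[i]) (e : R[i]) : Prop :=
  cintegrable Z /\ cexpectation P Z = e.

Lemma is_cexpectationD (X Y : T -> R[i]) (e f : R[i]) :
  is_cexpectation X e -> is_cexpectation Y f ->
  is_cexpectation (fun w => X w + Y w) (e + f).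
Proof.
move=> [[Xr Xi] <-] [[Yr Yi] <-].
have [Ir Er] := fine_expectation_lin 1 1 Xr Yr.
have [Ii Ei] := fine_expectation_lin 1 1 Xi Yi.
have ReD : (fun w => complex.Re (X w + Y w)) =
    (fun w => 1 * complex.Re (X w) + 1 * complex.Re (Y w)).
  by apply/funext => w; case: (X w) (Y w) => ? ? [? ?] /=; rewrite !mul1r.
have ImD : (fun w => complex.Im (X w + Y w)) =
    (fun w => 1 * complex.Im (X w) + 1 * complex.Im (Y w)).
  by apply/funext => w; case: (X w) (Y w) => ? ? [? ?] /=; rewrite !mul1r.
split; first by rewrite /cintegrable ReD ImD.
by rewrite /cexpectation ReD ImD Er Ei !mul1r.
Qed.

Lemma is_cexpectationZ (a : R[i]) (X : T -> R[i]) (e : R[i]) :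
  is_cexpectation X e -> is_cexpectation (fun w => a * X w) (a * e).
Proof.
move=> [[Xr Xi] <-]; case: a => a b.
have [Ir Er] := fine_expectation_lin a (- b) Xr Xi.
have [Ii Ei] := fine_expectation_lin a b Xi Xr.
have ReM : (fun w => complex.Re ((a +i* b) * X w)) =
    (fun w => a * complex.Re (X w) + - b * complex.Im (X w)).
  by apply/funext => w; case: (X w) => ? ? /=; rewrite mulNr.
have ImM : (fun w => complex.Im ((a +i* b) * X w)) =
    (fun w => a * complex.Im (X w) + b * complex.Re (X w)).
  by apply/funext => w; case: (X w) => ? ? /=.
split; first by rewrite /cintegrable ReM ImM.
by rewrite /cexpectation ReM ImM Er Ei mulNr.
Qed.

Lemma is_cexpectation0 : is_cexpectation (fun=> 0) 0.
Proof.
split; first by split; exact: Lfun_cst.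
by rewrite /cexpectation /= -/(cst 0) expectation_cst.
Qed.

Lemma is_cexpectation_sum (I : Type) (s : seq I) (X : I -> T -> R[i])
    (e : I -> R[i]) :
  (forall i, is_cexpectation (X i) (e i)) ->
  is_cexpectation (fun w => \sum_(i <- s) X i w) (\sum_(i <- s) e i).
Proof.
move=> Xe; elim: s => [|i s IHs].
  rewrite big_nil; under eq_fun do rewrite big_nil; exact: is_cexpectation0.
rewrite big_cons; under eq_fun do rewrite big_cons; exact: is_cexpectationD.
Qed.

Lemma is_cexpectation_mulmx (m n p q : nat) (A : 'M[R[i]]_(m, n))
    (B : 'M[R[i]]_(p, q)) (Z : T -> 'M[R[i]]_(n, p)) (E : 'M[R[i]]_(n, p)) :
  (forall i j, is_cexpectation (fun w => Z w i j) (E i j)) ->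
  forall i j, is_cexpectation (fun w => (A *m Z w *m B) i j) ((A *m E *m B) i j).
Proof.
move=> ZE i j.
(* Both constant factors are put on the left, the side on which [is_cexpectationZ] extracts them. *)
have mulE (C : 'M[R[i]]_(n, p)) :
    (A *m C *m B) i j = \sum_k B k j * (\sum_l A i l * C l k).
  by rewrite mxE; apply: eq_bigr => k _; rewrite mxE mulrC.
rewrite mulE; under eq_fun do rewrite mulE.
apply: is_cexpectation_sum => k; apply: is_cexpectationZ.
by apply: is_cexpectation_sum => l; apply: is_cexpectationZ.
Qed.

Lemma square_integrable_correlation (n : nat) (X : T -> 'cV[R[i]]_n) :
  square_integrable P X -> forall i j,
  is_cexpectation (fun w => (X w *m (X w)^t*) i j) (correlation_mx P X i j).
Proof.
move=> X2 i j; rewrite mxE; split => //.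
have [iR iI] := X2 i; have [jR jI] := X2 j.
have XE w : (X w *m (X w)^t*) i j = X w i 0 * (X w j 0)^*%C.
  by rewrite mxE big_ord1 !mxE.
have Lfun1_ext (f g : T -> R) : f =1 g -> g \in Lfun P 1 -> f \in Lfun P 1.
  by move=> /funext ->.
(* A product of two L2 functions is in L1. With entries a + ib and c + id, the product (a + ib)(c -
   id) has real part ac + bd and imaginary part bc - ad. *)
have [Ir _] := fine_expectation_lin 1 1 (Lfun2_mul_Lfun1 iR jR) (Lfun2_mul_Lfun1 iI jI).
have [Ii _] := fine_expectation_lin 1 (-1) (Lfun2_mul_Lfun1 iI jR) (Lfun2_mul_Lfun1 iR jI).
split; [apply: Lfun1_ext Ir | apply: Lfun1_ext Ii] => w; rewrite XE /=;
  case: (X w i 0) (X w j 0) => [? ?] [? ?] /=; ring.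
Qed.

Lemma correlation_mxM (m n : nat) (A : 'M[R[i]]_(m, n)) (X : T -> 'cV[R[i]]_n) :
  square_integrable P X ->
  correlation_mx P (fun w => A *m X w) = A *m correlation_mx P X *m A^t*.
Proof.
move=> X2; apply/matrixP => i j; rewrite [LHS]mxE.
rewrite -(is_cexpectation_mulmx A (A^t*) (square_integrable_correlation X2) i j).2.
congr (cexpectation P _); apply/funext => w.
by rewrite trmx_mul map_mxM !mulmxA.
Qed.

(** * Unique solvability of the reduced system, for both models *)

Lemma correlation_system_unique_solution (m n : nat) (A : 'M[R[i]]_(m, n))
    (S : {set 'I_n}) (X : T -> 'cV[R[i]]_n) (Z : T -> 'cV[R[i]]_m) :
  (m <= n)%N -> full_spark A -> (#|S| < 2 * m)%N ->
  square_integrable P X -> is_diag_mx (correlation_mx P X) ->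
  (forall i, i \notin S -> correlation_mx P X i i = 0) ->
  (forall w, Z w = A *m X w) ->
  exists! r : 'cV[R[i]]_#|S|,
    vec (correlation_mx P Z) =
    colset S (khatri_rao (map_mx Num.conj A) A) *m r.
Proof.
move=> lemn sA ltS X2 /is_diag_mxP dX X0 /funext ->.
pose r : 'cV[R[i]]_n := \col_i correlation_mx P X i i.
have rE : correlation_mx P X = diag_mx r^T.
  apply/matrixP => i j; rewrite [RHS]mxE [r^T _ _]mxE [r _ _]mxE.
  by have [->|/dX ->] := eqVneq i j.
(* Reading A^H as the transpose of the conjugate of A makes the conjugate the first Khatri-Rao
   factor. *)
rewrite correlation_mxM // rE -map_trmx (vec_mul_diag (map_mx Num.conj A) A r).
rewrite (colset_mulmx (S := S)) => [|j /X0]; last by rewrite [r _ _]mxE.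
(* The witness, found by unification, is the restriction of the diagonal [r] to [S]. *)
eexists; split; first by [].
move=> s rs; apply/eqP; rewrite -subr_eq0; apply/eqP.
apply: (full_spark_khatri_rao_inj lemn sA ltS).
by rewrite mulmxBr; apply/eqP; rewrite subr_eq0; apply/eqP; exact: rs.
Qed.

End ComplexExpectation.

Theorem theorem2 (R : realType) (d : measure_display) (T : measurableType d)
    (P : probability T R) :
  (* analog model *)
  (forall (M N K : nat) (fs : R) (A : 'M[R[i]]_(M, N)) (S : R -> {set 'I_N})
      (x : R -> T -> 'cV[R[i]]_N) (z : R -> T -> 'cV[R[i]]_M),
    let Fs := `[- (fs / 2), fs / 2] in
    let Phi := khatri_rao (map_mx Num.conj A) A in
    (0 < M)%N -> (M <= N)%N -> (0 < K)%N -> (K < N)%N -> 0 < fs ->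
    (forall f, f \in Fs ->
      [/\ #|S f| = K,
          square_integrable P (x f),
          is_diag_mx (correlation_mx P (x f)),
          forall i, i \notin S f -> correlation_mx P (x f) i i = 0
        & forall w, z f w = A *m x f w]) ->
    full_spark A -> (K <= M ^ 2)%N -> (K < 2 * M)%N ->
    forall f, f \in Fs ->
      exists! r : 'cV[R[i]]_#|S f|,
        vec (correlation_mx P (z f)) = colset (S f) Phi *m r)
  /\
  (* digital model *)
  (forall (M N K : nat) (A : 'M[R[i]]_(M, N)) (S : {set 'I_N})
      (x c : T -> 'cV[R[i]]_N) (z : T -> 'cV[R[i]]_M),
    let F := dftmx R N in
    let G := N%:R^-1 *: (A *m F^t*) in
    let Phi := khatri_rao (map_mx Num.conj G) G in
    (0 < M)%N -> (M < N)%N -> (0 < K)%N -> (K < N)%N ->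
    #|S| = K ->
    square_integrable P c ->
    is_diag_mx (correlation_mx P c) ->
    (forall i, i \notin S -> correlation_mx P c i i = 0) ->
    (forall w, x w = N%:R^-1 *: (F^t* *m c w)) ->
    (forall w, z w = A *m x w) ->
    full_spark (A *m F^t*) -> (K <= M ^ 2)%N -> (K < 2 * M)%N ->
    exists! r : 'cV[R[i]]_#|S|,
      vec (correlation_mx P z) = colset S Phi *m r).
Proof.
split.
  move=> M N K fs A S x z Fs Phi _ leMN _ _ _ xz sA _ ltK f fFs.
  have [cS x2 xd x0 zE] := xz f fFs.
  by apply: correlation_system_unique_solution zE; rewrite ?cS.
move=> M N K A S x c z F G Phi _ ltMN _ _ cS c2 cd c0 xE zE sA _ ltK.
(* Here z = G c, so the Fourier coefficients play the signal and [G] the sampling matrix. [G]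
   inherits full spark from A F^H, since 1/N is nonzero. *)
apply: (correlation_system_unique_solution (X := c)); rewrite ?cS //.
- exact: ltnW.
- apply: full_sparkZ sA.
  by rewrite invr_eq0 pnatr_eq0 -lt0n (leq_ltn_trans _ ltMN).
- by move=> w; rewrite zE xE -scalemxAr -scalemxAl mulmxA.
Qed.
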